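(* Assume that the objective function $g$ of the problem $\min_{\beta\in\mathbb{R}^p}g(\beta)$ is bounded below and that $\{\tau_{2,k}\}$ and $\{\iota_{2,k}\}$ are positive convergent sequences. Then every cluster point of the sequence $\{\beta^k\}$ generated by the PPMM algorithm (as described in the context) is a d-stationary point of the problem $\min_{\beta\in\mathbb{R}^p} g(\beta)$.
   Context: Problem. Let $X\in\mathbb{R}^{n\times p}$ with rows $X_1,\dots,X_n$, $b\in\mathbb{R}^n$, $\lambda>0$. Let $q_1:\mathbb{R}^p\to\mathbb{R}$ be a convex function whose proximal mapping is strongly semismooth (with respect to its Clarke generalized Jacobian), and $q_2:\mathbb{R}^p\to\mathbb{R}$ a convex smooth function. A locally Lipschitz map $R$ is strongly semismooth at $x$ if it is directionally differentiable at $x$ and $R(x+\Delta x)-R(x)-\Gamma\Delta x=O(\|\Delta x\|^{2})$ for all $\Gamma\in\partial R(x+\Delta x)$, $\Delta x\to0$. Put $$h(y):=\frac{1}{n(n-1)}\sum_{1\le i<j\le n}|y_i-y_j|\quad(y\in\mathbb{R}^n),\qquad g(\beta):=\frac{1}{n(n-1)}\sum_{1\le i<j\le n}|(b_i-X_i\beta)-(b_j-X_j\beta)|+\lambda q_1(\beta)-q_2(\beta),$$ so that $g(\beta)=h(X\beta-b)+\lambda q_1(\beta)-q_2(\beta)$. $\|\cdot\|$ is the Euclidean norm. For a proper lower semicontinuous convex function $r$ and $\sigma>0$, $\mathrm{Prox}_{\sigma r}(x):=\operatorname{argmin}_{w}\{r(w)+\frac{1}{2\sigma}\|w-x\|^2\}$.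 d-stationarity. A point $\bar\beta\in\mathbb{R}^p$ is a d-stationary (directional-stationary) point of $g$ (equivalently, of the problem $\min g$) if the directional derivative $g'(\bar\beta;v)=\lim_{t\downarrow0}\frac{g(\bar\beta+tv)-g(\bar\beta)}{t}$ satisfies $g'(\bar\beta;v)\ge0$ for all $v\in\mathbb{R}^p$. PPMM algorithm (Stage 2). The starting point $\beta^0\in\mathbb{R}^p$ (the output of a preliminary Stage 1) and $\tau_{2,0}>0$, $\iota_{2,0}>0$ are given, and $\tau_{2,k+1}=\rho_{2,k}\tau_{2,k}$, $\iota_{2,k+1}=\rho'_{2,k}\iota_{2,k}$ with $\rho_{2,k},\rho'_{2,k}\in(0,1)$. At iteration $k$ one computes an approximate solution $u^{k+1}\in\mathbb{R}^n$ of the (unconstrained, differentiable, convex) dual of $$\min_{\beta\in\mathbb{R}^p}\Big\{h(X\beta-b)+\lambda q_1(\beta)-q_2(\beta^k)-\langle\nabla q_2(\beta^k),\beta-\beta^k\rangle+\frac{\tau_{2,k}}{2}\|\beta-\beta^k\|^2+\frac{\iota_{2,k}}{2}\|X(\beta-\beta^k)\|^2\Big\},$$ and sets $$\beta^{k+1}=\mathrm{Prox}_{\tau_{2,k}^{-1}\lambda q_1}\big(-\tau_{2,k}^{-1}X^Tu^{k+1}+\tau_{2,k}^{-1}\nabla q_2(\beta^k)+\beta^k\big).$$ The residual $r^{k+1}\in\mathbb{R}^n$ is the gradient of the dual objective at $u^{k+1}$, i.e. $$r^{k+1}=\mathrm{Prox}_{\iota_{2,k}^{-1}h}\big(\iota_{2,k}^{-1}u^{k+1}+X\beta^k-b\big)-X\beta^{k+1}+b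 .$$ The approximate solution is required to be accurate enough that $$2h(r^{k+1})+\iota_{2,k}\|r^{k+1}\|^2\ \le\ \frac{\iota_{2,k}}{2}\|X(\beta^{k+1}-\beta^k)\|^2 .$$ Equivalently, $\beta^{k+1}=\operatorname{argmin}_{\beta\in\mathbb{R}^p}f_k(\beta)$, where $$f_k(\beta)=h(X\beta-b+r^{k+1})+\lambda q_1(\beta)-q_2(\beta^k)-\langle\nabla q_2(\beta^k),\beta-\beta^k\rangle+\frac{\tau_{2,k}}{2}\|\beta-\beta^k\|^2+\frac{\iota_{2,k}}{2}\|X(\beta-\beta^k)+r^{k+1}\|^2 .$$ The algorithm is regarded as running indefinitely, producing an infinite sequence $\{\beta^k\}$. *)

(* Defs.v *)
From mathcomp Require Import all_boot all_order all_algebra.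
From mathcomp Require Import all_classical all_reals all_analysis.

Set Implicit Arguments.
Unset Strict Implicit.
Unset Printing Implicit Defensive.

Import Order.TTheory GRing.Theory Num.Theory.
Import numFieldNormedType.Exports.

Local Open Scope classical_set_scope.
Local Open Scope ring_scope.

(* Elements of R^p are row vectors, as in the library's jacobian 'J, so the
   matrix-vector product X beta is [X *v beta], i.e. beta *m X^T.  The library
   norm `|x| on 'rV is the sup norm; the Euclidean norm is [enorm].  Topological
   notions (limits, cluster points, differentiability) do not depend on the
   choice between them. *)

Notation "X *v beta" := (beta *m X^T) (at level 40, left associativity) :
  ring_scope.

Definition dotv (R : realType) (p : nat) (x y : 'rV[R]_p) : R :=
  \sum_(j < p) x 0 j * y 0 j.

Definition enorm (R : realType) (p : nat) (x : 'rV[R]_p) : R :=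
  Num.sqrt (dotv x x).

Definition convex_fun (R : realType) (p : nat) (f : 'rV[R]_p -> R) : Prop :=
  convex_function [set: convex_lmodType 'rV[R]_p] f.

Definition gradient (R : realType) (p : nat) (f : 'rV[R]_p -> R)
    (x : 'rV[R]_p) : 'rV[R]_p :=
  \row_(j < p) 'D_(delta_mx 0 j) (f : 'rV[R]_p -> R^o) x.

(* "Smooth" means continuously differentiable. *)
Definition smooth (R : realType) (p : nat) (f : 'rV[R]_p -> R) : Prop :=
  (forall x, differentiable (f : 'rV[R]_p -> R^o) x) /\
  continuous (gradient f).

Definition has_dir_deriv (R : realType) (p : nat) (V : normedModType R)
    (f : 'rV[R]_p -> V) (x v : 'rV[R]_p) (l : V) : Prop :=
  t^-1 *: (f (x + t *: v) - f x) @[t --> (0 : R)^'+] --> l.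

(* The existence of the directional derivatives is part of the notion. *)
Definition d_stationary (R : realType) (p : nat) (g : 'rV[R]_p -> R)
    (x : 'rV[R]_p) : Prop :=
  forall v, exists2 l : R,
    has_dir_deriv (g : 'rV[R]_p -> R^o) x v l & 0 <= l.

Definition argmin (R : realType) (p : nat) (f : 'rV[R]_p -> R) :
    set 'rV[R]_p :=
  [set w | forall w', f w <= f w'].

(* Prox sigma r is Prox_{sigma r}.  For convex r : R^p -> R and sigma > 0 the
   argmin is a singleton; [get] extracts its element (and is a junk value if
   the argmin is empty, which does not happen in that case). *)
Definition Prox (R : realType) (p : nat) (sigma : R) (r : 'rV[R]_p -> R)
    (x : 'rV[R]_p) : 'rV[R]_p :=
  get (argmin (fun w => r w + (2 * sigma)^-1 * enorm (w - x) ^+ 2)).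

Definition conv_hull (R : realType) (V : lmodType R) (A : set V) : set V :=
  [set y | exists (m : nat) (c : 'I_m -> R) (a : 'I_m -> V),
     [/\ forall i, 0 <= c i, \sum_(i < m) c i = 1, forall i, A (a i)
       & y = \sum_(i < m) c i *: a i]].

(* Limits of Jacobians along sequences of differentiability points. *)
Definition B_subdifferential (R : realType) (p m : nat)
    (F : 'rV[R]_p -> 'rV[R]_m) (x : 'rV[R]_p) : set 'M[R]_(p, m) :=
  [set G | exists y : nat -> 'rV[R]_p,
     [/\ y @ \oo --> x, forall k, differentiable F (y k)
       & 'J F (y k) @[k --> \oo] --> G]].

Definition Clarke_jacobian (R : realType) (p m : nat)
    (F : 'rV[R]_p -> 'rV[R]_m) (x : 'rV[R]_p) : set 'M[R]_(p, m) :=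
  conv_hull (B_subdifferential F x).

Definition locally_lipschitz (R : realType) (p m : nat)
    (F : 'rV[R]_p -> 'rV[R]_m) : Prop :=
  forall x : 'rV[R]_p, lipschitz_on F (nbhs (x, x)).

Definition strongly_semismooth_at (R : realType) (p m : nat)
    (F : 'rV[R]_p -> 'rV[R]_m) (x : 'rV[R]_p) : Prop :=
  (forall v, exists l, has_dir_deriv F x v l) /\
  exists C : R, \forall d \near (0 : 'rV[R]_p),
    forall G, Clarke_jacobian F (x + d) G ->
      (* 'J acts on row vectors from the right *)
      enorm (F (x + d) - F x - d *m G) <= C * enorm d ^+ 2.

Definition strongly_semismooth (R : realType) (p m : nat)
    (F : 'rV[R]_p -> 'rV[R]_m) : Prop :=
  locally_lipschitz F /\ forall x, strongly_semismooth_at F x.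

(* For n <= 1 the sums below are empty, so the value of the factor 1/(n(n-1))
   is immaterial. *)
Definition hloss (R : realType) (n : nat) (y : 'rV[R]_n) : R :=
  (n%:R * (n%:R - 1))^-1 *
    \sum_(i < n) \sum_(j < n | (i < j)%N) `|y 0 i - y 0 j|.

Definition gobj (R : realType) (n p : nat) (X : 'M[R]_(n, p)) (b : 'rV[R]_n)
    (lambda : R) (q1 q2 : 'rV[R]_p -> R) (beta : 'rV[R]_p) : R :=
  (n%:R * (n%:R - 1))^-1 *
    \sum_(i < n) \sum_(j < n | (i < j)%N)
      `|(b 0 i - dotv (row i X) beta) - (b 0 j - dotv (row j X) beta)|
  + lambda * q1 beta - q2 beta.

Definition ppmm_next (R : realType) (n p : nat) (X : 'M[R]_(n, p))
    (lambda : R) (q1 q2 : 'rV[R]_p -> R) (tau : R)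
    (beta : 'rV[R]_p) (u : 'rV[R]_n) : 'rV[R]_p :=
  Prox tau^-1 (fun w => lambda * q1 w)
    (- (tau^-1 *: (X^T *v u)) + tau^-1 *: gradient q2 beta + beta).

Definition ppmm_residual (R : realType) (n p : nat) (X : 'M[R]_(n, p))
    (b : 'rV[R]_n) (iota : R) (beta beta' : 'rV[R]_p) (u : 'rV[R]_n) :
    'rV[R]_n :=
  Prox iota^-1 (@hloss R n) (iota^-1 *: u + X *v beta - b) - X *v beta' + b.

(* The sequence beta is generated by PPMM with parameters tau, iota and inexact
   dual solutions u (u 0 is unused); the initial point beta 0 is arbitrary. *)
Record PPMM (R : realType) (n p : nat) (X : 'M[R]_(n, p)) (b : 'rV[R]_n)
    (lambda : R) (q1 q2 : 'rV[R]_p -> R) (tau iota rho rho' : nat -> R)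
    (u : nat -> 'rV[R]_n) (beta : nat -> 'rV[R]_p) : Prop := {
  ppmm_tau0 : 0 < tau 0%N ;
  ppmm_iota0 : 0 < iota 0%N ;
  ppmm_rho : forall k, 0 < rho k < 1 ;
  ppmm_rho' : forall k, 0 < rho' k < 1 ;
  ppmm_tauS : forall k, tau k.+1 = rho k * tau k ;
  ppmm_iotaS : forall k, iota k.+1 = rho' k * iota k ;
  ppmm_betaS : forall k,
    beta k.+1 = ppmm_next X lambda q1 q2 (tau k) (beta k) (u k.+1) ;
  ppmm_accuracy : forall k,
    let r := ppmm_residual X b (iota k) (beta k) (beta k.+1) (u k.+1) in
    2 * hloss r + iota k * enorm r ^+ 2
      <= iota k / 2 * enorm (X *v (beta k.+1 - beta k)) ^+ 2
}.

(* Main.v *)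
Require Import Defs.
From mathcomp Require Import all_boot all_order all_algebra.
From mathcomp Require Import all_classical all_reals all_analysis.
From mathcomp Require Import ring lra.

Set Implicit Arguments.
Unset Strict Implicit.
Unset Printing Implicit Defensive.

Import Order.TTheory GRing.Theory Num.Theory.
Import numFieldNormedType.Exports.

Local Open Scope classical_set_scope.
Local Open Scope ring_scope.

(** Why the theorem holds.  Write Delta = beta_{k+1} - beta_k, let r be the
    residual at step k, and let |.| be the Euclidean norm.  Both proximal points
    of a step satisfy a subgradient inequality (Prox_subgradient): the one of
    lambda q1 at beta_{k+1}, with slope grad q2(beta_k) - tau Delta - X^T u, and
    the one of h at X beta_{k+1} - b + r, with slope u - iota (X Delta + r).
    When they are added, the dual vector u cancels, and ppmm_optimality remains:
    an inequality at beta_{k+1} against an arbitrary competitor w.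

    It is used twice, h being even and subadditive and q2 lying above its
    tangents.  With w = beta_k, the accuracy test absorbs all the error terms,
    and g decreases by at least iota/4 |X Delta|^2 (ppmm_descent).  With w
    arbitrary, completing squares removes Delta and gives (ppmm_majorant)
      g(beta_{k+1}) <= m_w(beta_k) + 2 (g(beta_k) - g(beta_{k+1})),
      m_w(y) = h(Xw - b) + lambda q1(w) - q2(y) - <grad q2(y), w - y>
               + tau/4 |w - y|^2 + iota/2 |X(w - y)|^2,
    where the inexactness is paid for by the decrease of g.

    As g is bounded below, the gaps g(beta_k) - g(beta_{k+1}) tend to 0, and as
    g is continuous and g(beta_k) decreases, g(x) <= g(beta_k) at a cluster
    point x.  The weights tau, iota decrease, so m_w may be taken with the
    initial ones; then it is a fixed continuous function and g(x) <= m_w(x) for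
    all w.  This route avoids the limit of Delta, which need not be 0 if tau
    tends to 0.

    With w = x + t v this says that f = h(X. - b) + lambda q1 grows along v at
    least like t <grad q2(x), v> - O(t^2).  The slopes of the convex f decrease
    to a limit as t decreases to 0, hence g has a directional derivative, and it
    is nonnegative (majorant_d_stationary).

    Two facts about finite convex functions q on R^p are needed for this: they
    are continuous, and q + c |. - x|^2 has a minimizer, so that the proximal
    maps are what they should be.  Both follow from convexv_bounds, where q is
    compared with q(x) through the l1 norm of the displacement. *)

(** * The inner product *)

Lemma dotvC (R : realType) (p : nat) (x y : 'rV[R]_p) : dotv x y = dotv y x.
Proof. by apply: eq_bigr => j _; rewrite mulrC. Qed.

Lemma dotvDl (R : realType) (p : nat) (x y z : 'rV[R]_p) :
  dotv (x + y) z = dotv x z + dotv y z.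
Proof. by rewrite -big_split; apply: eq_bigr => j _; rewrite mxE mulrDl. Qed.

Lemma dotvZl (R : realType) (p : nat) (a : R) (x y : 'rV[R]_p) :
  dotv (a *: x) y = a * dotv x y.
Proof. by rewrite mulr_sumr; apply: eq_bigr => j _; rewrite mxE mulrA. Qed.

Lemma dotvNl (R : realType) (p : nat) (x y : 'rV[R]_p) :
  dotv (- x) y = - dotv x y.
Proof. by rewrite -scaleN1r dotvZl mulN1r. Qed.

Lemma dotvDr (R : realType) (p : nat) (x y z : 'rV[R]_p) :
  dotv x (y + z) = dotv x y + dotv x z.
Proof. by rewrite !(dotvC x) dotvDl. Qed.

Lemma dotvZr (R : realType) (p : nat) (a : R) (x y : 'rV[R]_p) :
  dotv x (a *: y) = a * dotv x y.
Proof. by rewrite !(dotvC x) dotvZl. Qed.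

Lemma dotvNr (R : realType) (p : nat) (x y : 'rV[R]_p) :
  dotv x (- y) = - dotv x y.
Proof. by rewrite !(dotvC x) dotvNl. Qed.

Definition dotvE := (dotvDl, dotvDr, dotvNl, dotvNr, dotvZl, dotvZr).

Lemma dotv_ge0 (R : realType) (p : nat) (x : 'rV[R]_p) : 0 <= dotv x x.
Proof. by apply: sumr_ge0 => j _; rewrite -expr2 sqr_ge0. Qed.

Lemma sqr_enorm (R : realType) (p : nat) (x : 'rV[R]_p) :
  enorm x ^+ 2 = dotv x x.
Proof. by rewrite sqr_sqrtr ?dotv_ge0. Qed.

Lemma dotv_adjoint (R : realType) (n p : nat) (X : 'M[R]_(n, p))
    (u : 'rV[R]_n) (d : 'rV[R]_p) : dotv (X^T *v u) d = dotv u (X *v d).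
Proof.
have dotvE' m (x y : 'rV[R]_m) : dotv x y = (x *m y^T) 0 0.
  by rewrite mxE; apply: eq_bigr => j _; rewrite mxE.
by rewrite !dotvE' !trmx_mul !trmxK mulmxA.
Qed.

(** * Convex functions and the pairwise loss *)

(** Convexity in terms of a base point and a displacement, the form in which
    slopes and directional derivatives appear. *)
Definition convexv (R : realType) (p : nat) (f : 'rV[R]_p -> R) : Prop :=
  forall (x d : 'rV[R]_p) (t : R), 0 <= t <= 1 ->
    f (x + t *: d) <= f x + t * (f (x + d) - f x).

Lemma convex_fun_convexv (R : realType) (p : nat) (f : 'rV[R]_p -> R) :
  convex_fun f -> convexv f.
Proof.
move=> fc x d t /andP[t0 t1].
have := fc (Itv01 t0 t1) (x + d) x (mem_setT _) (mem_setT _).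
rewrite convRE /conv /= /unstable.onem.
have -> : t *: (x + d) + (1 - t) *: x = x + t *: d.
  by apply/rowP => j; rewrite !mxE; ring.
move=> /le_trans; apply.
by rewrite le_eqVlt; apply/orP; left; apply/eqP; ring.
Qed.

Lemma convexvD (R : realType) (p : nat) (f g : 'rV[R]_p -> R) :
  convexv f -> convexv g -> convexv (fun x => f x + g x).
Proof.
by move=> fc gc x d t t01; have := fc x d t t01; have := gc x d t t01; lra.
Qed.

Lemma convexvZ (R : realType) (p : nat) (a : R) (f : 'rV[R]_p -> R) :
  0 <= a -> convexv f -> convexv (fun x => a * f x).
Proof.
move=> a0 fc x d t t01; have := ler_wpM2l a0 (fc x d t t01); lra.
Qed.

Lemma convexv_affine (R : realType) (n p : nat) (X : 'M[R]_(n, p))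
    (b : 'rV[R]_n) (f : 'rV[R]_n -> R) :
  convexv f -> convexv (fun x => f (X *v x - b)).
Proof.
move=> fc x d t t01.
rewrite !mulmxDl -scalemxAl (addrAC _ (t *: _)) (addrAC _ (_ *m _)).
exact: fc.
Qed.

Lemma hlossZ (R : realType) (n : nat) (a : R) (y : 'rV[R]_n) :
  hloss (a *: y) = `|a| * hloss y.
Proof.
rewrite /hloss mulrCA; congr (_ * _).
rewrite mulr_sumr; apply: eq_bigr => i _.
rewrite mulr_sumr; apply: eq_bigr => j _.
by rewrite !mxE -mulrBr normrM.
Qed.

Lemma hlossD (R : realType) (n : nat) (y z : 'rV[R]_n) :
  hloss (y + z) <= hloss y + hloss z.
Proof.
rewrite /hloss -mulrDr; apply: ler_wpM2l.
  case: n y z => [|n] _ _; first by rewrite mul0r invr0.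
  by rewrite invr_ge0 mulr_ge0 // -natr1 addrK.
rewrite -big_split; apply: ler_sum => i _.
rewrite -big_split; apply: ler_sum => j _.
by rewrite !mxE opprD addrACA ler_normD.
Qed.

Lemma hloss_convexv (R : realType) (n : nat) : convexv (@hloss R n).
Proof.
move=> x d t /andP[t0 t1].
have -> : x + t *: d = (1 - t) *: x + t *: (x + d).
  by apply/rowP => j; rewrite !mxE; ring.
apply: le_trans (hlossD _ _) _.
by rewrite !hlossZ !ger0_norm ?subr_ge0 //; lra.
Qed.

Lemma gobjE (R : realType) (n p : nat) (X : 'M[R]_(n, p)) (b : 'rV[R]_n)
    (lambda : R) (q1 q2 : 'rV[R]_p -> R) (x : 'rV[R]_p) :
  gobj X b lambda q1 q2 x = hloss (X *v x - b) + lambda * q1 x - q2 x.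
Proof.
rewrite /gobj /hloss; congr (_ * _ + _ - _).
apply: eq_bigr => i _; apply: eq_bigr => j _.
have E k : (X *v x - b) 0 k = dotv (row k X) x - b 0 k.
  by rewrite !mxE; congr (_ - _); apply: eq_bigr => l _; rewrite !mxE mulrC.
by rewrite !E -normrN; congr `|_|; ring.
Qed.

(** * Continuity of finite convex functions *)

(** Induction on the set of coordinates that move: a displacement is the
    midpoint of twice its step along one axis and twice the rest, and along an
    axis convexity bounds f by its values at the two unit steps.  Each doubling
    halves the radius delta. *)
Lemma convexv_local_upper (R : realType) (p : nat) (f : 'rV[R]_p -> R)
    (x : 'rV[R]_p) (s : seq 'I_p) : convexv f ->
  exists delta C : R, [/\ 0 < delta, 0 <= C & forall d : 'rV[R]_p,
    (forall j, `|d 0 j| <= delta) ->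
    f (x + \sum_(j <- s) d 0 j *: delta_mx 0 j)
      <= f x + C * \sum_(j <- s) `|d 0 j|].
Proof.
move=> fc; elim: s => [|i s [delta [C [delta0 C0 IH]]]].
  by exists 1, 0; split=> // d _; rewrite !big_nil mulr0 !addr0.
pose e := delta_mx 0 i : 'rV[R]_p.
pose M := `|f (x + e) - f x| + `|f (x - e) - f x|.
have M1 : f (x + e) - f x <= M.
  by apply: le_trans (ler_norm _) _; rewrite lerDl.
have M2 : f (x - e) - f x <= M.
  by apply: le_trans (ler_norm _) _; rewrite lerDr.
have M0 : 0 <= M by rewrite addr_ge0.
have axis a : `|a| <= 1 -> f (x + a *: e) <= f x + M * `|a|.
  move=> a1; case: (lerP 0 a) => a0.
    have a01 : 0 <= a <= 1 by rewrite a0 (le_trans (ler_norm _) a1).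
    apply: le_trans (fc x e a a01) _.
    by rewrite lerD2l (mulrC M) (ger0_norm a0) ler_wpM2l.
  have a01 : 0 <= - a <= 1.
    by rewrite oppr_ge0 (ltW a0) -(ltr0_norm a0).
  have := fc x (- e) (- a) a01.
  rewrite scalerN scaleNr opprK => /le_trans; apply.
  rewrite lerD2l (mulrC M) (ltr0_norm a0) ler_wpM2l //.
  by case/andP: a01.
exists (Num.min 1 delta / 2), (M + C); split=> [||d dle].
- by rewrite divr_gt0 // lt_min ltr01.
- exact: addr_ge0.
have d2 j : `|(2 *: d) 0 j| <= Num.min 1 delta.
  by rewrite mxE normrM ger0_norm // mulrC -ler_pdivlMr.
(* the midpoint of the axis step and of the remaining steps, both doubled *)
pose y := x + (2 *: d) 0 i *: e.
pose z := x + \sum_(j <- s) (2 *: d) 0 j *: delta_mx 0 j.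
have IHd : f z <= f x + C * \sum_(j <- s) `|(2 *: d) 0 j|.
  by apply: IH => j; apply: le_trans (d2 j) _; rewrite ge_min lexx orbT.
have Ax : f y <= f x + M * `|(2 *: d) 0 i|.
  by apply: axis; apply: le_trans (d2 i) _; rewrite ge_min lexx.
have half01 : 0 <= (2 : R)^-1 <= 1 by lra.
have := fc y (z - y) 2^-1 half01.
have -> : y + (z - y) = z by rewrite addrC subrK.
have sum2 : \sum_(j <- s) (2 *: d) 0 j *: delta_mx 0 j
    = 2 *: \sum_(j <- s) d 0 j *: delta_mx 0 j :> 'rV[R]_p.
  by rewrite scaler_sumr; apply: eq_bigr => j _; rewrite mxE scalerA.
have -> : y + 2^-1 *: (z - y)
    = x + \sum_(j <- i :: s) d 0 j *: delta_mx 0 j.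
  rewrite big_cons -/e /z /y sum2.
  by apply/rowP => j; rewrite !mxE; field.
move=> /le_trans; apply; rewrite big_cons.
have norm2 : \sum_(j <- s) `|(2 *: d) 0 j| = 2 * \sum_(j <- s) `|d 0 j|.
  by rewrite mulr_sumr; apply: eq_bigr => j _; rewrite mxE normrM ger0_norm.
rewrite norm2 in IHd; rewrite mxE normrM ger0_norm // in Ax.
move: (f y) (f z) IHd Ax => fy fz IHd Ax.
have S0 : 0 <= \sum_(j <- s) `|d 0 j| by apply: sumr_ge0.
have := mulr_ge0 M0 S0; have := mulr_ge0 C0 (normr_ge0 (d 0 i)).
lra.
Qed.

Definition l1norm (R : realType) (p : nat) (d : 'rV[R]_p) : R :=
  \sum_(j < p) `|d 0 j|.

Lemma l1norm_ge0 (R : realType) (p : nat) (d : 'rV[R]_p) : 0 <= l1norm d.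
Proof. exact: sumr_ge0. Qed.

Lemma le_l1norm (R : realType) (p : nat) (d : 'rV[R]_p) (j : 'I_p) :
  `|d 0 j| <= l1norm d.
Proof. by rewrite /l1norm (bigD1 j) //= lerDl sumr_ge0. Qed.

(** The lower bound comes from the upper one: x is the midpoint of x + t d and
    x - t d, and for t small the latter is in the range of the upper bound.
    Convexity along d then makes the lower bound hold for all d, which gives the
    coercivity of proximal objectives. *)
Lemma convexv_bounds (R : realType) (p : nat) (f : 'rV[R]_p -> R)
    (x : 'rV[R]_p) : convexv f ->
  exists delta C : R, [/\ 0 < delta, 0 <= C,
    forall d, l1norm d <= delta -> f (x + d) <= f x + C * l1norm d &
    forall d, f x - C * l1norm d <= f (x + d)].
Proof.
move=> fc.
have [delta [C [delta0 C0 up]]] := convexv_local_upper x (index_enum 'I_p) fc.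
have upper d : l1norm d <= delta -> f (x + d) <= f x + C * l1norm d.
  move=> dle; have := up d (fun j => le_trans (le_l1norm d j) dle).
  by rewrite -row_sum_delta.
exists delta, C; split=> // d.
(* this t lies in ]0, 1] and brings t d into the ball of radius delta *)
pose t := delta / (delta + l1norm d).
have den0 : 0 < delta + l1norm d by rewrite ltr_wpDr ?l1norm_ge0.
have t0 : 0 < t by rewrite divr_gt0.
have t1 : t <= 1 by rewrite ler_pdivrMr // mul1r lerDl l1norm_ge0.
have normtd : l1norm (- (t *: d)) = t * l1norm d.
  rewrite mulr_sumr; apply: eq_bigr => j _.
  by rewrite !mxE normrN normrM gtr0_norm.
have tdle : l1norm (- (t *: d)) <= delta.
  rewrite normtd /t mulrAC -mulrA ler_piMr ?(ltW delta0) //.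
  by rewrite ler_pdivrMr // mul1r lerDr ltW.
have t01 : 0 <= t <= 1 by rewrite (ltW t0) t1.
have half01 : 0 <= (2 : R)^-1 <= 1 by lra.
have := fc x d t t01.
have := upper _ tdle; rewrite normtd.
(* x is the midpoint of x + t d and x - t d *)
have := fc (x + t *: d) (- (2 * t) *: d) 2^-1 half01.
have -> : x + t *: d + 2^-1 *: (- (2 * t) *: d) = x.
  by apply/rowP => j; rewrite !mxE; field.
have -> : x + t *: d + - (2 * t) *: d = x - t *: d.
  by apply/rowP => j; rewrite !mxE; ring.
move=> h1 h2 h3.
rewrite -(ler_pM2l t0); lra.
Qed.

Lemma cvg_sum_ord (R : realType) (p : nat) (T : Type) (F : set_system T)
    (f : 'I_p -> T -> R) (a : 'I_p -> R) : Filter F ->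
  (forall j, f j @ F --> a j) ->
  \sum_(j < p) f j t @[t --> F] --> \sum_(j < p) a j.
Proof.
move=> FF fa.
exact: (@cvg_big R _ _ _ _ (@add_continuous R) _ _ _ _ _ _ (fun j _ => fa j)).
Qed.

Lemma cvg_coord (R : realType) (p : nat) (T : Type) (F : set_system T)
    (f : T -> 'rV[R]_p) (a : 'rV[R]_p) (j : 'I_p) : Filter F ->
  f @ F --> a -> f t 0 j @[t --> F] --> a 0 j.
Proof.
move=> FF fa.
exact: (@continuous_cvg _ _ _ F FF f (fun M : 'rV[R]_p => M 0 j) a
  (@coord_continuous R 1 p 0 j a) fa).
Qed.

Lemma cvg_dotv (R : realType) (p : nat) (T : Type) (F : set_system T)
    (f g : T -> 'rV[R]_p) (a b : 'rV[R]_p) : Filter F ->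
  f @ F --> a -> g @ F --> b -> dotv (f t) (g t) @[t --> F] --> dotv a b.
Proof.
move=> FF fa gb; rewrite /dotv; apply: cvg_sum_ord => j.
by apply: cvgM; apply: cvg_coord.
Qed.

Lemma cvg_l1norm0 (R : realType) (p : nat) (T : Type) (F : set_system T)
    (f : T -> 'rV[R]_p) (x : 'rV[R]_p) : Filter F ->
  f @ F --> x -> l1norm (f t - x) @[t --> F] --> (0 : R).
Proof.
move=> FF fx.
have -> : (0 : R) = l1norm (x - x).
  by rewrite /l1norm big1 // => j _; rewrite subrr mxE normr0.
rewrite /l1norm; apply: cvg_sum_ord => j.
apply: cvg_norm; apply: cvg_coord.
by apply: cvgB => //; exact: cvg_cst.
Qed.

Lemma cvg_convexv (R : realType) (p : nat) (q : 'rV[R]_p -> R) (T : Type)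
    (F : set_system T) (f : T -> 'rV[R]_p) (x : 'rV[R]_p) : Filter F ->
  convexv q -> f @ F --> x -> q (f t) @[t --> F] --> q x.
Proof.
move=> FF qc fx; have [delta [C [delta0 C0 up low]]] := convexv_bounds x qc.
have E y : y = x + (y - x) by rewrite addrC subrK.
have norm0 := cvg_l1norm0 FF fx.
have Cnorm0 : C * l1norm (f t - x) @[t --> F] --> (0 : R).
  by rewrite -(mulr0 C); apply: cvgM => //; exact: cvg_cst.
apply: (@squeeze_cvgr _ _ _ _ (fun t => q x - C * l1norm (f t - x))
  (fun t => q x + C * l1norm (f t - x))).
- near=> t; rewrite {2 3}(E (f t)) low up //.
  by near: t; exact: (cvgr_le _ norm0).
- by rewrite -[X in _ --> X]subr0; apply: cvgB => //; exact: cvg_cst.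
- by rewrite -[X in _ --> X]addr0; apply: cvgD => //; exact: cvg_cst.
Unshelve. all: by end_near.
Qed.

(** * Proximal points *)

(** Writing w = x + d, the lower bound of convexv_bounds shows that the
    objective exceeds its value at x by at least c times the sum of the
    |d_j|^2 - k |d_j|, with k = C/c.  This is positive as soon as some |d_j|
    exceeds (p + 1) k, because each of the other terms is at least - k^2.  So a
    minimizer over the corresponding compact box is a global one. *)
Lemma convexv_prox_argmin (R : realType) (p : nat) (f : 'rV[R]_p -> R)
    (c : R) (x : 'rV[R]_p) : convexv f -> 0 < c ->
  argmin (fun w => f w + c * enorm (w - x) ^+ 2) !=set0.
Proof.
move=> fc c0; set F := fun w => _.
have [delta [C [_ C0 _ low]]] := convexv_bounds x fc.
pose M := p.+1%:R * C / c.
pose box := [set w : 'rV[R]_p |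
  forall i, `[x 0 i - M, x 0 i + M]%classic (w ord0 i)].
have M0 : 0 <= M by rewrite divr_ge0 ?mulr_ge0 // ltW.
have boxx : box x.
  by move=> i /=; rewrite in_itv /= gerBl lerDl M0.
have cbox : compact box.
  apply: (@rV_compact R p (fun i => `[x 0 i - M, x 0 i + M]%classic)) => i.
  exact: segment_compact.
have Fcont : continuous F.
  move=> w.
  have cvgF G : Filter G -> G --> w -> F y @[y --> G] --> F w.
    move=> FG Gw; rewrite /F; under eq_cvg do rewrite sqr_enorm.
    rewrite sqr_enorm; apply: cvgD; first exact: (@cvg_convexv R p f _ G id).
    apply: cvgM; first exact: cvg_cst.
    by apply: cvg_dotv; apply: cvgB => //; exact: cvg_cst.
  exact: (cvgF _ (nbhs_filter w)).
have [w0 w0box w0min] := EVT_min_rV (ex_intro _ x boxx) cbox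
  (continuous_subspaceT Fcont).
exists w0 => w.
have [Fw|Fw] := lerP (F w) (F x); last first.
  by apply: le_trans (ltW Fw); apply: w0min; rewrite inE.
apply: w0min; rewrite inE => i /=; rewrite in_itv /=.
suff : `|(w - x) 0 i| <= M by rewrite !mxE ler_norml; lra.
move: Fw; rewrite /F !sqr_enorm; set d := w - x.
have -> : w = x + d by rewrite addrC subrK.
have -> : dotv (x - x) (x - x) = 0 by rewrite subrr -(scale0r x) dotvZl mul0r.
rewrite mulr0 addr0 => Fw.
pose k := C / c; have k0 : 0 <= k by rewrite divr_ge0 // ltW.
have Ck : C = c * k by rewrite /k mulrC divfK // gt_eqF.
have {}Fw : \sum_(j < p) (`|d 0 j| ^+ 2 - k * `|d 0 j|) <= 0.
  have sumE : c * \sum_(j < p) (`|d 0 j| ^+ 2 - k * `|d 0 j|)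
      = c * dotv d d - C * l1norm d.
    rewrite Ck -mulrA -mulrBr sumrB -mulr_sumr; congr (_ * (_ - _)).
    by apply: eq_bigr => j _; rewrite -normrX ger0_norm ?sqr_ge0 // expr2.
  by rewrite -(pmulr_rle0 _ c0) sumE; have := low d; lra.
move: Fw; rewrite (bigD1 i) //= => Fw.
have rest : - (p%:R * k ^+ 2)
    <= \sum_(j < p | j != i) (`|d 0 j| ^+ 2 - k * `|d 0 j|).
  have -> : - (p%:R * k ^+ 2) = \sum_(j < p) - k ^+ 2.
    by rewrite sumr_const card_ord mulNrn mulr_natl.
  rewrite [leLHS](bigD1 i) //=.
  apply: le_trans (_ : _ <= \sum_(j < p | j != i) - k ^+ 2) _.
    by rewrite gerDr oppr_le0 sqr_ge0.
  by apply: ler_sum => j _; nra.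
have -> : M = p.+1%:R * k by rewrite /M mulrA.
rewrite leNgt; apply/negP; rewrite -natr1 => big_entry.
have p0 : 0 <= p%:R :> R by [].
have pk0 := mulr_ge0 p0 k0.
nra.
Qed.

(** Lets t tend to 0 in an inequality with a remainder of order t. *)
Lemma ler_of_small (R : realType) (A B D : R) :
  (forall t, 0 < t <= 1 -> A <= B + t * D) -> A <= B.
Proof.
move=> small; apply/ler_addgt0Pr => e e0.
have den0 : 0 < e + `|D| by rewrite ltr_wpDr.
(* this t lies in ]0, 1] and satisfies t D <= e *)
have /small : 0 < e / (e + `|D|) <= 1.
  by rewrite divr_gt0 //= ler_pdivrMr // mul1r lerDl.
move=> /le_trans; apply; rewrite lerD2l mulrAC ler_pdivrMr // ler_pM2l //.
by rewrite (le_trans (ler_norm D)) // lerDr ltW.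
Qed.

(** The first-order optimality condition of the proximal problem, obtained by
    comparing the minimizer P with P + t (w - P) and letting t tend to 0. *)
Lemma Prox_subgradient (R : realType) (p : nat) (f : 'rV[R]_p -> R)
    (sigma : R) (x w : 'rV[R]_p) : convexv f -> 0 < sigma ->
  f (Prox sigma f x)
    + sigma^-1 * dotv (x - Prox sigma f x) (w - Prox sigma f x) <= f w.
Proof.
move=> fc s0; have c0 : 0 < (2 * sigma)^-1 by rewrite invr_gt0 mulr_gt0.
have := getPex (convexv_prox_argmin x fc c0); rewrite -/(Prox sigma f x).
set P := Prox sigma f x => Pmin; set d := w - P; set e := x - P.
have wE : w = P + d by rewrite addrC subrK.
have key t : 0 < t <= 1 ->
    sigma^-1 * dotv e d <= f w - f P + t * ((2 * sigma)^-1 * dotv d d).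
  move=> /andP[t0 t1]; have := Pmin (P + t *: d) => /=.
  have t01 : 0 <= t <= 1 by rewrite (ltW t0) t1.
  have := fc P d t t01; rewrite -wE !sqr_enorm.
  have -> : P + t *: d - x = t *: d - e.
    by rewrite /e opprB addrCA addrA.
  have -> : P - x = - e by rewrite opprB.
  clearbody d e; rewrite !dotvE (dotvC d e) => h1 h2.
  rewrite -(ler_pM2l t0).
  have -> : sigma^-1 = 2 * (2 * sigma)^-1 by field; rewrite gt_eqF.
  lra.
have /ler_of_small := key; lra.
Qed.

(** * One step of the algorithm *)

Lemma hlossN (R : realType) (n : nat) (y : 'rV[R]_n) : hloss (- y) = hloss y.
Proof. by rewrite -scaleN1r hlossZ normrN normr1 mul1r. Qed.

(** Sum of the two subgradient inequalities: the residual is chosen so that the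
    proximal point of hloss is X *v beta' - b + r, and the contribution of u to
    the slope of hloss is opposite to its contribution to that of lambda q1. *)
Lemma ppmm_optimality (R : realType) (n p : nat) (X : 'M[R]_(n, p))
    (b : 'rV[R]_n) (lambda tau iota : R) (q1 q2 : 'rV[R]_p -> R)
    (beta beta' w : 'rV[R]_p) (u : 'rV[R]_n)
    (r := ppmm_residual X b iota beta beta' u) :
  0 < lambda -> 0 < tau -> 0 < iota -> convexv q1 ->
  beta' = ppmm_next X lambda q1 q2 tau beta u ->
  hloss (X *v beta' - b + r) + lambda * q1 beta'
    + dotv (gradient q2 beta - tau *: (beta' - beta)) (w - beta')
    - iota * dotv (X *v (beta' - beta) + r) (X *v (w - beta'))
    <= hloss (X *v w - b + r) + lambda * q1 w.
Proof.
move=> lambda0 tau0 iota0 q1c beta'E.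
have lq1c : convexv (fun w => lambda * q1 w) by exact: convexvZ (ltW _) q1c.
have taui : 0 < tau^-1 by rewrite invr_gt0.
have iotai : 0 < iota^-1 by rewrite invr_gt0.
have := Prox_subgradient (- (tau^-1 *: (X^T *v u)) + tau^-1 *: gradient q2 beta
  + beta) w lq1c taui.
rewrite -/(ppmm_next X lambda q1 q2 tau beta u) -beta'E invrK => opt1.
have := Prox_subgradient (iota^-1 *: u + X *v beta - b) (X *v w - b + r)
  (@hloss_convexv R n) iotai.
set P := Prox _ _ _.
have -> : P = X *v beta' - b + r.
  by rewrite /r /ppmm_residual -/P; apply/rowP => j; rewrite !mxE; ring.
have -> : X *v w - b + r - (X *v beta' - b + r) = X *v (w - beta').
  by rewrite mulmxBl; apply/rowP => j; rewrite !mxE; ring.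
have -> : iota^-1 *: u + X *v beta - b - (X *v beta' - b + r)
    = iota^-1 *: u - (X *v (beta' - beta) + r).
  by rewrite mulmxBl; apply/rowP => j; rewrite !mxE; ring.
rewrite invrK => opt2.
move: opt1 opt2.
have -> : - (tau^-1 *: (X^T *v u)) + tau^-1 *: gradient q2 beta + beta - beta'
    = - (tau^-1 *: (X^T *v u)) + tau^-1 *: gradient q2 beta - (beta' - beta).
  by rewrite opprB addrA.
move: (w - beta') (beta' - beta) => e d; clearbody r.
rewrite !(dotvDl, dotvNl, dotvZl) dotv_adjoint.
move=> opt1 opt2.
have E1 z : tau * (tau^-1 * z) = z by rewrite mulVKf // gt_eqF.
have E2 z : iota * (iota^-1 * z) = z by rewrite mulVKf // gt_eqF.
have := E1 (dotv (gradient q2 beta) e); have := E1 (dotv u (X *v e)).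
have := E2 (dotv u (X *v e)).
lra.
Qed.

Section OneStep.
Variables (R : realType) (n p : nat) (X : 'M[R]_(n, p)) (b : 'rV[R]_n).
Variables (lambda tau iota : R) (q1 q2 : 'rV[R]_p -> R).
Variables (beta beta' : 'rV[R]_p) (u : 'rV[R]_n).
Let r := ppmm_residual X b iota beta beta' u.
Let g := gobj X b lambda q1 q2.
Hypotheses (lambda_gt0 : 0 < lambda) (tau_gt0 : 0 < tau) (iota_gt0 : 0 < iota).
Hypothesis q1c : convexv q1.
Hypothesis q2_grad : forall y,
  q2 beta + dotv (gradient q2 beta) (y - beta) <= q2 y.
Hypothesis beta'E : beta' = ppmm_next X lambda q1 q2 tau beta u.
Hypothesis accuracy : 2 * hloss r + iota * enorm r ^+ 2
  <= iota / 2 * enorm (X *v (beta' - beta)) ^+ 2.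

(** The competitor is beta.  With a = X *v (beta' - beta), what the accuracy
    test leaves of the error terms is covered because
    a.a/4 + a.r + r.r = |a + 2 r|^2/4 is nonnegative. *)
Lemma ppmm_descent :
  g beta' + iota / 4 * enorm (X *v (beta' - beta)) ^+ 2 <= g beta.
Proof.
have := ppmm_optimality b beta lambda_gt0 tau_gt0 iota_gt0 q1c beta'E.
rewrite -/r -(opprB beta' beta) mulNmx => opt.
have hr y : hloss (y + r) <= hloss y + hloss r by exact: hlossD.
have hrN y : hloss y <= hloss (y + r) + hloss r.
  by have := hlossD (y + r) (- r); rewrite addrK hlossN.
have := hr (X *v beta - b); have := hrN (X *v beta' - b).
have := q2_grad beta'; move: accuracy opt.
rewrite /g !gobjE !sqr_enorm.
move: (beta' - beta) => d; move: (X *v d) => a; clearbody r.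
rewrite !dotvE.
have := mulr_ge0 (ltW iota_gt0) (dotv_ge0 (a + 2 *: r)).
rewrite !dotvE (dotvC a r).
have := mulr_ge0 (ltW tau_gt0) (dotv_ge0 d).
lra.
Qed.

(** With a = X *v (beta' - beta), e = X *v (w - beta), d = beta' - beta and
    f = w - beta, the steps d and a disappear by completing the squares
    tau/4 |2 d - f|^2, iota/4 |2 a + r - e|^2 and iota/4 |r - e|^2.  The
    remaining error 2 hloss r + iota/2 |r|^2 is at most iota/2 |a|^2 by the
    accuracy test, hence at most twice the decrease of g. *)
Lemma ppmm_majorant (w : 'rV[R]_p) :
  g beta' <= hloss (X *v w - b) + lambda * q1 w - q2 beta
    - dotv (gradient q2 beta) (w - beta)
    + tau / 4 * enorm (w - beta) ^+ 2
    + iota / 2 * enorm (X *v (w - beta)) ^+ 2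
    + 2 * (g beta - g beta').
Proof.
have := ppmm_optimality b w lambda_gt0 tau_gt0 iota_gt0 q1c beta'E.
have -> : w - beta' = (w - beta) - (beta' - beta).
  by rewrite opprB addrA subrK.
rewrite -/r (mulmxBl (w - beta)) => opt.
have := ppmm_descent; move: accuracy.
have hr y : hloss (y + r) <= hloss y + hloss r by exact: hlossD.
have hrN y : hloss y <= hloss (y + r) + hloss r.
  by have := hlossD (y + r) (- r); rewrite addrK hlossN.
have := hr (X *v w - b); have := hrN (X *v beta' - b).
have := q2_grad beta'; move: opt.
rewrite /g !gobjE !sqr_enorm.
move: (beta' - beta) (w - beta) => d f.
move: (X *v d) (X *v f) => a e; clearbody r.
have := mulr_ge0 (ltW iota_gt0) (dotv_ge0 (2 *: a + (r - e))).
have := mulr_ge0 (ltW iota_gt0) (dotv_ge0 (r - e)).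
have := mulr_ge0 (ltW iota_gt0) (dotv_ge0 r).
have := mulr_ge0 (ltW tau_gt0) (dotv_ge0 (2 *: d - f)).
rewrite !dotvE (dotvC r a) (dotvC e a) (dotvC e r) (dotvC f d).
lra.
Qed.

End OneStep.

(** * Directional derivatives *)

Lemma gradient_dir_deriv (R : realType) (p : nat) (q : 'rV[R]_p -> R)
    (x v : 'rV[R]_p) : differentiable (q : 'rV[R]_p -> R^o) x ->
  has_dir_deriv (q : 'rV[R]_p -> R^o) x v (dotv (gradient q x) v).
Proof.
move=> qx.
have -> : dotv (gradient q x) v = 'D_v (q : 'rV[R]_p -> R^o) x :> R^o.
  rewrite deriveE // {2}(row_sum_delta v) linear_sum; apply: eq_bigr => j _.
  by rewrite linearZ /= mxE deriveE // mulrC.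
have /cvg_ex [l ql] : derivable (q : 'rV[R]_p -> R^o) x v.
  exact: diff_derivable.
apply: cvg_dnbhs_at_right.
have -> : 'D_v (q : 'rV[R]_p -> R^o) x = l by exact: cvg_lim ql.
by under eq_fun do rewrite (addrC x).
Qed.

Lemma convexv_slope_le (R : realType) (p : nat) (f : 'rV[R]_p -> R)
    (x v : 'rV[R]_p) (s t : R) : convexv f -> 0 < s -> s <= t ->
  s^-1 * (f (x + s *: v) - f x) <= t^-1 * (f (x + t *: v) - f x).
Proof.
move=> fc s0 st; have t0 := lt_le_trans s0 st.
have r01 : 0 <= s / t <= 1.
  by rewrite (divr_ge0 (ltW s0) (ltW t0)) /= ler_pdivrMr // mul1r.
have := fc x (t *: v) _ r01; rewrite scalerA divfK ?gt_eqF // => slope.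
rewrite ler_pdivrMl // mulrA lerBlDl; exact: slope.
Qed.

Lemma gradient_le (R : realType) (p : nat) (q : 'rV[R]_p -> R)
    (x y : 'rV[R]_p) : convexv q ->
  differentiable (q : 'rV[R]_p -> R^o) x ->
  q x + dotv (gradient q x) (y - x) <= q y.
Proof.
move=> qc qd; have qx := @gradient_dir_deriv R p q x (y - x) qd.
rewrite -lerBrDl; move: (qx) => /cvg_lim <- //.
apply: limr_le; first by apply/cvg_ex; eexists; exact: qx.
near=> t.
have t0 : 0 < t by near: t; exact: nbhs_right_gt.
have t1 : t <= 1 by near: t; exact: nbhs_right_le.
have := convexv_slope_le x (y - x) qc t0 t1.
by rewrite invr1 mul1r scale1r (addrC x (y - x)) subrK.
Unshelve. all: by end_near.
Qed.

(** Slopes of f increase with t, so the hypothesis, after t tends to 0, bounds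
    every slope of f from below by <grad q(x), v>.  Hence the slopes have a
    limit at 0 from the right, which is at least <grad q(x), v>, the
    corresponding derivative of q. *)
Lemma majorant_d_stationary (R : realType) (p : nat)
    (f q g : 'rV[R]_p -> R) (x : 'rV[R]_p) :
  convexv f -> differentiable (q : 'rV[R]_p -> R^o) x ->
  (forall y, g y = f y - q y) ->
  (forall v, exists K : R, forall t, 0 < t <= 1 ->
    f x + t * dotv (gradient q x) v <= f (x + t *: v) + t ^+ 2 * K) ->
  d_stationary g x.
Proof.
move=> fc qx gE maj v.
pose slope t := t^-1 * (f (x + t *: v) - f x).
have slope_ge t : 0 < t -> dotv (gradient q x) v <= slope t.
  move=> t0; have [K majK] := maj v.
  (* the hypothesis is used at s m with m = min(1, t), below both 1 and t *)
  apply: (@ler_of_small _ _ _ (Num.min 1 t * K)) => s /andP[s0 s1].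
  pose m := Num.min 1 t; have m0 : 0 < m by rewrite lt_min ltr01.
  have sm0 : 0 < s * m by rewrite mulr_gt0.
  have smm : s * m <= m by rewrite ler_piMl // ltW.
  have smt : s * m <= t by rewrite (le_trans smm) // ge_min lexx orbT.
  have sm1 : s * m <= 1 by rewrite (le_trans smm) // ge_min lexx.
  rewrite -lerBlDr; apply: le_trans (convexv_slope_le x v fc sm0 smt).
  rewrite lerBlDr -(ler_pM2l sm0) mulrDr mulVKf ?gt_eqF //.
  have := majK (s * m); rewrite sm0 sm1 => /(_ isT).
  rewrite -/m; lra.
have [l slope_l l_ge] : exists2 l : R,
    slope t @[t --> (0 : R)^'+] --> l & dotv (gradient q x) v <= l.
  exists (inf [set slope t | t in `]0, 1[%classic]).
    apply: (@nondecreasing_at_right_cvgr R slope 0 (BLeft 1)).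
    - by rewrite bnd_simp.
    - move=> s t; rewrite !in_itv /= => /andP[s0 _] _ st.
      exact: convexv_slope_le.
    - exists (dotv (gradient q x) v) => _ [t tI <-]; apply: slope_ge.
      by move: tI; rewrite /= in_itv /= => /andP[].
  apply: lb_le_inf.
    by exists (slope 2^-1), 2^-1 => //=; rewrite in_itv /=; lra.
  move=> _ [t tI <-]; apply: slope_ge.
  by move: tI; rewrite /= in_itv /= => /andP[].
exists (l - dotv (gradient q x) v); last by rewrite subr_ge0.
rewrite /has_dir_deriv.
under eq_cvg => t.
  rewrite !gE [_ *: _](_ : _ = slope t
    - t^-1 *: (q (x + t *: v) - q x : R^o)); last first.
    by rewrite /slope -mulrBr; congr (_ * _); ring.
  over.
by apply: (cvgB slope_l); exact: gradient_dir_deriv.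
Qed.

(** * Cluster points of a descent sequence *)

Lemma cluster_seq (T : topologicalType) (u : nat -> T) (x : T) (B : set T)
    (N : nat) : cluster (u @ \oo) x -> nbhs x B ->
  exists2 k, (N <= k)%N & B (u k).
Proof.
move=> ux Bx.
have tailN : (u @ \oo) [set y | exists2 k, (N <= k)%N & y = u k].
  by exists N => // k /= Nk; exists k.
by have [_ [[k Nk ->] Bk]] := ux _ _ tailN Bx; exists k.
Qed.

Lemma cluster_le (T : topologicalType) (R : realType) (u : nat -> T) (x : T)
    (G : T -> R) (delta : nat -> R) (c : R) :
  cluster (u @ \oo) x -> G @ x --> G x -> delta @ \oo --> (0 : R) ->
  (forall k, c <= G (u k) + delta k) -> c <= G x.
Proof.
move=> ux Gx delta0 le_c; apply/ler_addgt0Pr => e e0.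
have e20 : 0 < e / 2 by rewrite divr_gt0.
have [N _ delta_small] := cvgr_le _ delta0 _ e20.
have GB : nbhs x [set y | G y <= G x + e / 2].
  by apply: (cvgr_le _ Gx); rewrite ltrDl.
have [k /delta_small /= dk /= Gk] := cluster_seq N ux GB.
by have := le_c k; lra.
Qed.

Lemma nonincreasing_cluster_le (T : topologicalType) (R : realType)
    (u : nat -> T) (x : T) (g : T -> R) :
  cluster (u @ \oo) x -> g @ x --> g x ->
  (forall k, g (u k.+1) <= g (u k)) -> forall k, g x <= g (u k).
Proof.
move=> ux gx decr k; rewrite leNgt; apply/negP => gk.
have [m km /=] := cluster_seq k ux (cvgr_gt _ gx _ gk).
rewrite ltNge => /negP; apply.
have decr_homo : {homo g \o u : m n / (m <= n)%N >-> n <= m}.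
  exact/nonincreasing_seqP.
exact: decr_homo.
Qed.

Lemma gap_cvg0 (R : realType) (a : nat -> R) (m : R) :
  (forall k, a k.+1 <= a k) -> (forall k, m <= a k) ->
  a k - a k.+1 @[k --> \oo] --> (0 : R).
Proof.
move=> decr low.
have /cvg_ex [l al] : cvgn a.
  apply: nonincreasing_is_cvgn; first exact/nonincreasing_seqP.
  by exists m => _ [k _ <-].
by rewrite -(subrr l); apply: cvgB => //; rewrite -cvg_shiftS in al.
Qed.

(** Continuity in y of the model m_w(y) of the proof outline; a stands for the
    terms that depend on w only. *)
Lemma ppmm_model_cvg (R : realType) (n p : nat) (X : 'M[R]_(n, p))
    (q : 'rV[R]_p -> R) (a tau iota : R) (w x : 'rV[R]_p)
    (F : set_system 'rV[R]_p) : Filter F -> F --> x ->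
  convexv q -> continuous (gradient q) ->
  a - q y - dotv (gradient q y) (w - y) + tau / 4 * enorm (w - y) ^+ 2
      + iota / 2 * enorm (X *v (w - y)) ^+ 2 @[y --> F]
    --> a - q x - dotv (gradient q x) (w - x) + tau / 4 * enorm (w - x) ^+ 2
      + iota / 2 * enorm (X *v (w - x)) ^+ 2.
Proof.
move=> FF Fx qc gradc.
have XE y : enorm (X *v y) ^+ 2 = \sum_(j < n) dotv y (row j X) ^+ 2.
  rewrite sqr_enorm; apply: eq_bigr => j _; rewrite -expr2; congr (_ ^+ 2).
  by rewrite mxE; apply: eq_bigr => k _; rewrite !mxE.
have Gx : gradient q @ F --> gradient q x.
  exact: (@continuous_cvg _ _ _ F FF id (gradient q) x (gradc x) Fx).
have wF : w - y @[y --> F] --> w - x by apply: cvgB; [exact: cvg_cst|exact: Fx].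
rewrite !XE !sqr_enorm; under eq_cvg do rewrite XE !sqr_enorm.
apply: cvgD; first apply: cvgD; first apply: cvgB; first apply: cvgB.
- exact: cvg_cst.
- exact: (@cvg_convexv R p q _ F id).
- exact: cvg_dotv.
- by apply: cvgM; [exact: cvg_cst|exact: cvg_dotv].
- apply: cvgM; first exact: cvg_cst.
  apply: cvg_sum_ord => j; rewrite expr2; under eq_cvg do rewrite expr2.
  by apply: cvgM; apply: cvg_dotv => //; exact: cvg_cst.
Qed.

(** * Stationarity of cluster points *)

Theorem theorem4p2 (R : realType) (n p : nat) (X : 'M[R]_(n, p))
    (b : 'rV[R]_n) (lambda : R) (q1 q2 : 'rV[R]_p -> R)
    (tau iota rho rho' : nat -> R)
    (u : nat -> 'rV[R]_n) (beta : nat -> 'rV[R]_p)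
    (lambda_gt0 : 0 < lambda)
    (q1_convex : convex_fun q1)
    (q1_prox : strongly_semismooth (Prox 1 q1))
    (q2_convex : convex_fun q2)
    (q2_smooth : smooth q2)
    (g_bounded_below : exists m : R, forall x, m <= gobj X b lambda q1 q2 x)
    (tau_gt0 : forall k, 0 < tau k) (tau_cvg : cvgn tau)
    (iota_gt0 : forall k, 0 < iota k) (iota_cvg : cvgn iota)
    (beta_ppmm : PPMM X b lambda q1 q2 tau iota rho rho' u beta) :
  forall betabar : 'rV[R]_p, cluster (beta @ \oo) betabar ->
    d_stationary (gobj X b lambda q1 q2) betabar.
Proof.
move=> x beta_x.
have [m g_ge] := g_bounded_below.
have [q2_diff q2_grad] := q2_smooth.
have q1c := convex_fun_convexv q1_convex.
have q2c := convex_fun_convexv q2_convex.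
pose g := gobj X b lambda q1 q2.
pose f y := hloss (X *v y - b) + lambda * q1 y.
have fc : convexv f.
  apply: convexvD; first exact: (convexv_affine X b (@hloss_convexv R n)).
  exact: convexvZ (ltW _) q1c.
have gE y : g y = f y - q2 y by exact: gobjE.
have q2_le k y : q2 (beta k) + dotv (gradient q2 (beta k)) (y - beta k) <= q2 y.
  exact: gradient_le.
have g_cvg : g @ x --> g x.
  suff cvgF F : Filter F -> F --> x -> g @ F --> g x.
    exact: cvgF (nbhs_filter x) (@cvg_id _ (nbhs x)).
  move=> FF Fx; rewrite gE; under eq_cvg do rewrite gE.
  by apply: cvgB; exact: (@cvg_convexv R p _ _ F id).
have antitone (r a : nat -> R) : (forall k, 0 < r k < 1) ->
    (forall k, 0 < a k) -> (forall k, a k.+1 = r k * a k) ->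
    forall k, a k <= a 0%N.
  move=> r01 a0 aS; elim=> // k; apply: le_trans.
  by rewrite aS ler_piMl ?(ltW (a0 k)) //; case/andP: (r01 k) => _ /ltW.
have tau_le := antitone _ _ (ppmm_rho beta_ppmm) tau_gt0 (ppmm_tauS beta_ppmm).
have iota_le :=
  antitone _ _ (ppmm_rho' beta_ppmm) iota_gt0 (ppmm_iotaS beta_ppmm).
have descent k : g (beta k.+1) <= g (beta k).
  have := ppmm_descent lambda_gt0 (tau_gt0 k) (iota_gt0 k) q1c (q2_le k)
    (ppmm_betaS beta_ppmm k) (ppmm_accuracy beta_ppmm k).
  apply: le_trans; rewrite lerDl mulr_ge0 ?sqr_ge0 //.
  by rewrite divr_ge0 // ltW.
have g_le := nonincreasing_cluster_le beta_x g_cvg descent.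
have gap0 := gap_cvg0 descent (fun k => g_ge (beta k)).
have gap20 : 2 * (g (beta k) - g (beta k.+1)) @[k --> \oo] --> (0 : R).
  by rewrite -(mulr0 2); apply: cvgM => //; exact: cvg_cst.
have majorant w : g x <= f w - q2 x - dotv (gradient q2 x) (w - x)
    + tau 0%N / 4 * enorm (w - x) ^+ 2
    + iota 0%N / 2 * enorm (X *v (w - x)) ^+ 2.
  apply: (cluster_le (G := fun y => f w - q2 y - dotv (gradient q2 y) (w - y)
    + tau 0%N / 4 * enorm (w - y) ^+ 2
    + iota 0%N / 2 * enorm (X *v (w - y)) ^+ 2) beta_x _ gap20).
    by apply: ppmm_model_cvg => //; exact: nbhs_filter.
  move=> k; apply: le_trans (g_le k.+1) _.
  apply: le_trans (ppmm_majorant lambda_gt0 (tau_gt0 k) (iota_gt0 k) q1c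
    (q2_le k) (ppmm_betaS beta_ppmm k) (ppmm_accuracy beta_ppmm k) w) _.
  rewrite lerD2r; apply: lerD; last by rewrite ler_wpM2r ?sqr_ge0 // ler_pM2r.
  by rewrite lerD2l ler_wpM2r ?sqr_ge0 // ler_pM2r.
apply: (majorant_d_stationary fc (q2_diff x) gE) => v.
exists (tau 0%N / 4 * dotv v v + iota 0%N / 2 * dotv (X *v v) (X *v v)).
move=> t _; have := majorant (x + t *: v).
rewrite gE (addrC x) addrK !sqr_enorm -scalemxAl !dotvE; lra.
Qed.
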